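(* Let $n \ge 2$, let $\mu_1, \mu_2, \dots, \mu_n$ be non-atomic Borel probability measures on $[0,1]$, and let $\alpha_1, \alpha_2, \dots, \alpha_n$ be non-negative real numbers with $\sum_{i=1}^n \alpha_i = 1$. Then there exists a partition $[0,1] = X_1 \cup X_2 \cup \dots \cup X_n$ into pairwise disjoint sets with $\mu_i(X_i) \ge \alpha_i$ for all $1 \le i \le n$, obtained by cutting $[0,1]$ at no more than $3n-4$ points (i.e., the interval is divided by at most $3n-4$ cut points into at most $3n-3$ subintervals, and each $X_i$ is a union of some of these subintervals).
   Context: A partition $X_1 \cup \dots \cup X_n$ of $[0,1]$ with $\mu_i(X_i) \ge \alpha_i$ for all $i$ is called a disproportionate division for the demands $\alpha_1,\dots,\alpha_n$. The number of cuts of such a division is the number of points at which $[0,1]$ is cut so that each piece $X_i$ is a union of the resulting intervals. *)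

(* Defs.v *)
(* R : realType carries its Borel sigma-algebra. *)
From HB Require Import structures.
From mathcomp Require Import all_boot all_order all_algebra.
From mathcomp Require Import all_classical all_reals all_analysis.
Set Implicit Arguments. Unset Strict Implicit. Unset Printing Implicit Defensive.
Import Order.TTheory GRing.Theory Num.Theory.
Local Open Scope classical_set_scope.
Local Open Scope ring_scope.

(* A Borel probability measure on [0,1], represented as a Borel measure on R
   that is concentrated on [0,1] and has total mass 1 there. *)
Definition prob_on01 (R : realType) (mu : {measure set R -> \bar R}) : Prop :=
  mu `[0%R, 1%R]%classic = 1%E /\ mu (~` `[0%R, 1%R]%classic) = 0%E.

Definition nonatomic (R : realType) (mu : {measure set R -> \bar R}) : Prop :=
  forall A : set R, measurable A -> (0 < mu A)%E ->
    exists B : set R, [/\ measurable B, B `<=` A & (0 < mu B < mu A)%E].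

Definition cut_points (R : realType) (s : seq R) : seq R := 0 :: rcons s 1.

(* The j-th subinterval (open; j < size s + 1) determined by the cuts s. *)
Definition piece (R : realType) (s : seq R) (j : nat) : set R :=
  `](nth 0 (cut_points s) j), (nth 0 (cut_points s) j.+1)[%classic.

(* Main.v *)
(* Induction on the number of agents, for lists of continuous nondecreasing
   distribution functions on [a, b] whose total increments are at least the
   total demand; this form needs no renormalisation in the recursion.  Move x
   from a to b.  At x = a the agent who values [a, x] most values it at most at
   his demand, and at x = b at least at his demand, so by connectedness there is
   an x at which two (possibly equal) agents i and j both value [a, x] most, with
   common value M and alpha_i <= M <= alpha_j.  Share [a, x] between i, with
   demand alpha_i, and j, with demand M - alpha_i; then share [x, b] among all
   agents but i, the demand of j being lowered by M - alpha_i.  As two agents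
   need only 2 cuts, each step costs 3 cuts. *)
Require Import Defs.
From HB Require Import structures.
From mathcomp Require Import all_boot all_order all_algebra.
From mathcomp Require Import all_classical all_reals all_analysis.
From mathcomp Require Import lra zify.
Import Order.TTheory GRing.Theory Num.Theory.
Import numFieldNormedType.Exports.
Local Open Scope classical_set_scope.
Local Open Scope ring_scope.
Set Implicit Arguments. Unset Strict Implicit. Unset Printing Implicit Defensive.

(** * Divisions as lists of labelled endpoints, and the case of two agents *)

Section Divisions.
Context {R : realType} {I : finType}.
Implicit Types (F : I -> R -> R) (G H : R -> R) (i j : I) (L : seq (I * R)).

(* [(i, r)] in a list starting at [a] gives agent [i] the interval from the
   previous endpoint up to [r]. *)
Fixpoint share G i (a : R) L : R :=
  if L is (l, r) :: L' then (if l == i then G r - G a else 0) + share G i r L'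
  else 0.

Lemma share_cat G i a L1 L2 :
  share G i a (L1 ++ L2) =
  share G i a L1 + share G i (last a (map snd L1)) L2.
Proof.
elim: L1 a => [|[l r] L1 IH] a /=; first by rewrite add0r.
by rewrite IH addrA.
Qed.

Lemma share_ge0 G i a L : {homo G : x y / x <= y} ->
  path <=%R a (map snd L) -> 0 <= share G i a L.
Proof.
move=> homG; elim: L a => [//|[l r] L IH] a /= /andP[ar rL].
by rewrite addr_ge0 ?IH //; case: ifP => // _; rewrite subr_ge0 homG.
Qed.

Lemma share_strict a L : path <=%R a (map snd L) -> exists L',
  [/\ path <%R a (map snd L'), last a (map snd L') = last a (map snd L),
      (size L' <= size L)%N & forall G i, share G i a L' = share G i a L].
Proof.
elim: L a => [|[l r] L IH] a /=; first by exists [::].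
move=> /andP[ar /IH[L' [pL' lL' sL' shL']]].
have [ar'|/(conj ar)/andP/le_anti ra] := ltP a r.
  exists ((l, r) :: L'); split; rewrite /= ?ar' //.
  by move=> G i; rewrite shL'.
exists L'; rewrite ra; split; rewrite // 1?ltnW //.
by move=> G i; rewrite subrr shL'; case: ifP; rewrite add0r.
Qed.

(** Each endpoint belongs to the interval that it closes; [i0] is only a default beyond the last
    endpoint. *)
Fixpoint owner i0 L (x : R) : I :=
  if L is (l, r) :: L' then if x <= r then l else owner i0 L' x else i0.

Lemma owner_piece i0 L a (j : nat) x :
  path <=%R a (map snd L) -> (j < size L)%N ->
  nth 0 (a :: map snd L) j < x < nth 0 (a :: map snd L) j.+1 ->
  owner i0 L x = nth i0 (map fst L) j.
Proof.
elim: L a j => [|[l r] L IH] a [|j] //= /andP[ar pL] jL.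
  by case/andP => _ /ltW ->.
move=> xj; rewrite leNgt (IH r j) //.
suff -> : r < x by [].
case/andP: xj => + _; apply: le_lt_trans.
have /(sorted_leq_nth le_trans lexx 0 (s := r :: map snd L)) := pL.
by move=> /(_ 0%N j) /=; rewrite !inE /= size_map; apply; rewrite // ltnW.
Qed.

Definition is_division (a b : R) L :=
  path <=%R a (map snd L) /\ last a (map snd L) = b.

Lemma is_division_cat a b c L1 L2 :
  is_division a b L1 -> is_division b c L2 -> is_division a c (L1 ++ L2).
Proof.
move=> [p1 l1] [p2 l2]; split; first by rewrite map_cat cat_path p1 l1.
by rewrite map_cat last_cat l1.
Qed.

Lemma continuous_IVT G (a b v : R) : continuous G -> a <= b ->
  G a <= v <= G b -> exists2 c, a <= c <= b & G c = v.
Proof.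
move=> cG ab /andP[av vb].
have [||c] := @IVT R G a b v ab; first exact: continuous_subspaceT.
  by rewrite ge_min le_max av vb orbT.
by rewrite in_itv /=; exists c.
Qed.

(* On the circle obtained by gluing [a] to [b], an arc that starts at a maximum
   of [H - G] has an [H]-increment at most its [G]-increment. When this arc
   passes through the gluing point, [x, y] below is its complement. *)
Lemma two_agents_arc G H (a b V p : R) : continuous G -> continuous H ->
  a <= b -> G b - G a = V -> H b - H a = V -> 0 <= p <= V ->
  exists x y, [/\ a <= x, x <= y, y <= b &
    (G y - G x = p /\ H y - H x <= p) \/
    (G y - G x = V - p /\ V - p <= H y - H x)].
Proof.
move=> cG cH ab GV HV /andP[p0 pV].
have [|x0] := @EVT_max R (fun x => H x - G x) a b ab.
  apply: continuous_subspaceT => x; apply: cvgB; [exact: cH | exact: cG].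
rewrite in_itv /= => /andP[ax0 x0b] maxx0.
have maxE t : a <= t -> t <= b -> H t - G t <= H x0 - G x0.
  by move=> ? ?; apply: maxx0; rewrite in_itv /=; apply/andP.
have [le|gt] := leP (G x0 + p) (G b).
  have [|y /andP[x0y yb] Gy] := @continuous_IVT G x0 b (G x0 + p) cG x0b.
    by apply/andP; split => //; lra.
  exists x0, y; split => //; left.
  by have := maxE _ (le_trans ax0 x0y) yb; split; lra.
have [|y /andP[ay yx0] Gy] := @continuous_IVT G a x0 (G x0 + p - V) cG ax0.
  by apply/andP; split; lra.
exists y, x0; split => //; right.
by have := maxE _ ay (le_trans yx0 x0b); split; lra.
Qed.

(** Once both functions are scaled to increase by exactly [p + q], an arc worth [p] to [i] and at
    most [p] to [j] leaves at least [q] to [j]. Cut open at the gluing point, the arc and its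
    complement form three intervals. *)
Lemma two_agents G H i j (a b p q : R) :
  continuous G -> continuous H ->
  {homo G : x y / x <= y} -> {homo H : x y / x <= y} -> i != j ->
  a <= b -> 0 <= p -> 0 <= q -> p + q <= G b - G a -> p + q <= H b - H a ->
  exists L, [/\ is_division a b L, (size L <= 3)%N,
    p <= share G i a L & q <= share H j a L].
Proof.
move=> cG cH hG hH ij ab p0 q0 pG pH.
have ji : j == i = false by rewrite eq_sym (negbTE ij).
(* Here [p = q = 0]; this case is split off because the denominators below could vanish. *)
have [V0|V0] := leP (p + q) 0.
  exists [:: (i, b)]; split => //=; rewrite ?eqxx ?(negbTE ij).
    by split; rewrite /= ?ab.
    by lra.
  by lra.
(* Both factors are at most 1, so by monotonicity the true increments dominate the scaled ones. *)
pose V := p + q; pose g := V / (G b - G a); pose h := V / (H b - H a).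
have g0 : 0 < g by rewrite divr_gt0 //; lra.
have h0 : 0 < h by rewrite divr_gt0 //; lra.
have g1 : g <= 1 by rewrite ler_pdivrMr ?mul1r //; lra.
have h1 : h <= 1 by rewrite ler_pdivrMr ?mul1r //; lra.
have gV : g * G b - g * G a = V by rewrite -mulrBr /g divfK //; lra.
have hV : h * H b - h * H a = V by rewrite -mulrBr /h divfK //; lra.
have shr (k d : R) : k <= 1 -> 0 <= d -> k * d <= d by move=> ? ?; nra.
have incG x y : x <= y -> g * G y - g * G x <= G y - G x.
  by move=> xy; rewrite -mulrBr shr // subr_ge0 hG.
have incH x y : x <= y -> h * H y - h * H x <= H y - H x.
  by move=> xy; rewrite -mulrBr shr // subr_ge0 hH.
have [|||x [y [ax xy yb]]] := @two_agents_arc (fun x => g * G x) (fun x => h * H x)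
    a b V p _ _ ab gV hV.
- by move=> x; apply: cvgM; [exact: cvg_cst | exact: cG].
- by move=> x; apply: cvgM; [exact: cvg_cst | exact: cH].
- by rewrite p0 lerDl.
have := (incG _ _ ax, incG _ _ xy, incG _ _ yb).
have := (incH _ _ ax, incH _ _ xy, incH _ _ yb).
move=> [[h_1 h_2] h_3] [[g_1 g_2] g_3].
rewrite /V in gV hV *.
(* In the first case [[x, y]] is the arc and goes to [i]; in the second it is the complement and
   goes to [j]. *)
case=> -[e1 e2].
  exists [:: (j, x); (i, y); (j, b)]; split => //=.
  - by split; rewrite //= ax xy yb.
  - by rewrite ji eqxx; lra.
  - by rewrite (negbTE ij) eqxx; lra.
exists [:: (i, x); (j, y); (i, b)]; split => //=.
- by split; rewrite //= ax xy yb.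
- by rewrite ji eqxx; lra.
- by rewrite (negbTE ij) eqxx; lra.
Qed.

End Divisions.

(** * Balanced points and the induction on the number of agents *)

Section Existence.
Context {R : realType} {I : finType}.
Implicit Types (F : I -> R -> R) (i j k : I) (A : {set I}).

Lemma balanced_point F A (alpha : I -> R) (a b : R) i0 :
  (forall i, continuous (F i)) -> a <= b -> i0 \in A ->
  (forall i, i \in A -> 0 <= alpha i <= F i b - F i a) ->
  exists x i j, [/\ a <= x <= b, i \in A, j \in A &
    [/\ alpha i <= F i x - F i a, F i x - F i a <= alpha j,
        F j x - F j a = F i x - F i a &
        forall k, k \in A -> F k x - F k a <= F i x - F i a]].
Proof.
move=> cF ab i0A alphaF; pose m k x := F k x - F k a.
have cm k : continuous (m k).
  by move=> x; apply: cvgB; [exact: cF | exact: cvg_cst].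
have cltop i : closed [set x | forall k, k \in A -> m k x <= m i x].
  have -> : [set x | forall k, k \in A -> m k x <= m i x] =
      \bigcap_(k in [set` A]) (m k \- m i) @^-1` [set y | y <= 0].
    by apply/seteqP; split => x /= h k /h; rewrite /= subr_le0.
  apply: closed_bigI => k _; apply: preimage_closed; last exact: closed_le.
  by move=> x _; apply: cvgB; exact: cm.
have top x : exists2 i, i \in A & forall k, k \in A -> m k x <= m i x.
  by case: (@Order.TotalTheory.arg_maxP _ _ _ i0 (mem A) (fun i => m i x) i0A) => i iA le;
    exists i.
(* In [P] some agent of maximal value reaches his demand, in [Q] some such agent does not exceed it.
   Both are finite unions of closed sets, and a common point yields [i] and [j]. *)
pose P := \bigcup_(i in [set` A])
  ([set x | forall k, k \in A -> m k x <= m i x] `&` [set x | alpha i <= m i x]).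
pose Q := \bigcup_(i in [set` A])
  ([set x | forall k, k \in A -> m k x <= m i x] `&` [set x | m i x <= alpha i]).
have clP : closed P.
  apply: closed_bigcup => // i _; apply: closedI => //.
  by apply: (@preimage_closed _ _ (m i) [set y | alpha i <= y]);
    [move=> x _; exact: cm | exact: closed_ge].
have clQ : closed Q.
  apply: closed_bigcup => // i _; apply: closedI => //.
  by apply: (@preimage_closed _ _ (m i) [set y | y <= alpha i]);
    [move=> x _; exact: cm | exact: closed_le].
suff [x [xab [i iA [topi ai]] [j jA [topj aj]]]] : exists x, [/\ a <= x <= b, P x & Q x].
  have e : m j x = m i x by apply: le_anti; rewrite topi ?topj.
  by exists x, i, j; split => //; split => //; rewrite -/(m i x) -e.
apply: contrapT => noPQ.
have PQ x : a <= x <= b -> ~ Q x -> P x.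
  move=> xab nQ; have [i iA topi] := top x; exists i => //; split => //=.
  by rewrite leNgt; apply/negP => /ltW lt; apply: nQ; exists i.
have Pb : P b.
  by have [i iA topi] := top b; exists i => //; split => //=; case/andP: (alphaF i iA).
have Qa : Q a.
  have [i iA topi] := top a; exists i => //; split => //=; rewrite /m subrr.
  by case/andP: (alphaF i iA).
(* Without a common point, [P] and the complement of [Q] agree on [[a, b]]. This trace is open,
   closed and contains [b], hence is everything, against [Q a]. *)
have e : `[a, b]%classic `&` ~` Q = `[a, b]%classic.
  apply: (@segment_connected R a b).
  - exists b; split; first by rewrite /= in_itv /= ab lexx.
    by move=> Qb; apply: noPQ; exists b; rewrite ab lexx.
  - by exists (~` Q) => //; exact: closed_openC.
  - exists P => //; apply/seteqP; split => x /= []; rewrite in_itv /= => xab.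
      by move=> nQ; split => //; exact: PQ.
    by move=> Px; split => // Qx; apply: noPQ; exists x.
have : `[a, b]%classic a by rewrite /= in_itv /= ab lexx.
by rewrite -e => -[].
Qed.

(** The bound counts intervals, one more than the cuts; [maxn 1] covers a single agent, for whom
    [3 * #|A| - 3] is 0. *)
Lemma disproportionate_division F A (alpha : I -> R) (a b : R) :
  (forall i, continuous (F i)) -> (forall i, {homo F i : x y / x <= y}) ->
  (0 < #|A|)%N -> a <= b -> (forall i, i \in A -> 0 <= alpha i) ->
  (forall i, i \in A -> \sum_(k in A) alpha k <= F i b - F i a) ->
  exists L, [/\ is_division a b L, (size L <= maxn 1 (3 * #|A| - 3))%N &
    forall i, i \in A -> alpha i <= share (F i) i a L].
Proof.
move=> cF hF; have [n] := ubnP #|A|.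
elim: n A alpha a b => // n IH A alpha a b ltn A0 ab alpha0 total.
have [le1|gt1] := leqP #|A| 1.
  have /eqP/cards1P[i Ai] : #|A| = 1%N by apply/eqP; rewrite eqn_leq le1.
  exists [:: (i, b)]; split => //; first by split; rewrite /= ?ab.
    by rewrite /= leq_max.
  move=> k kA; move: (total k kA); rewrite Ai big_set1.
  by move: kA; rewrite Ai inE => /eqP -> /=; rewrite eqxx addr0.
(* Two agents form a base case of their own: a step down to one agent could cost 3 + 1 intervals
   instead of 3. *)
have [A2|A2] := eqVneq #|A| 2%N.
  have /eqP/cards2P[i [j [ij Aij]]] := A2.
  have iA : i \in A by rewrite Aij !inE eqxx.
  have jA : j \in A by rewrite Aij !inE eqxx orbT.
  have tot k : k \in A -> alpha i + alpha j <= F k b - F k a.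
    by move/total; rewrite Aij big_setU1 ?inE //= big_set1.
  have [L [dL sL Li Lj]] := two_agents (cF i) (cF j) (hF i) (hF j) ij ab
    (alpha0 _ iA) (alpha0 _ jA) (tot _ iA) (tot _ jA).
  exists L; split => //; first by rewrite A2.
  by move=> k; rewrite Aij !inE => /orP[] /eqP ->.
have {gt1 A2} A3 : (2 < #|A|)%N by rewrite ltn_neqAle eq_sym A2.
have [i0 i0A] := card_gt0P A0.
have sumD i : i \in A -> \sum_(k in A) alpha k = alpha i + \sum_(k in A :\ i) alpha k.
  by move=> iA; rewrite (big_setD1 i).
have [|x [i [j [/andP[ax xb] iA jA [ai aj eij topi]]]]] :=
  balanced_point cF ab i0A (alpha := alpha).
  move=> i iA; rewrite alpha0 //=; apply: le_trans (total i iA).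
  by rewrite (sumD _ iA) lerDl sumr_ge0 // => k /setD1P[_ /alpha0].
have cardD : #|A| = #|A :\ i|.+1 by rewrite (cardsD1 i) iA.
pose M := F i x - F i a.
(* If [j = i], the value [M] is exactly the demand of [i], who takes all of [[a, x]]; nobody else
   loses more than [M]. *)
have [eji|ji] := eqVneq j i.
  have M_i : alpha i = M by apply: le_anti; apply/andP; split; rewrite // -eji.
  have [| | | |L [dL sL shL]] := IH (A :\ i) alpha x b _ _ xb.
  - by rewrite -ltnS -cardD.
  - by rewrite -ltnS -cardD (leq_trans _ A3).
  - by move=> k /setD1P[_ /alpha0].
  - move=> k /setD1P[_ kA]; move: (total k kA) (topi k kA).
    by rewrite (sumD i) // M_i /M; lra.
  exists ((i, x) :: L); split.
  - by case: dL => pL lL; split; rewrite /= ?ax.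
  - by move: sL A3; rewrite cardD /=; lia.
  - move=> k kA /=; case: (eqVneq i k) => [<-|ki]; last first.
      by rewrite add0r shL // !inE eq_sym ki.
    by rewrite (le_trans ai) // lerDl share_ge0 //; case: dL.
pose alpha' k := if k == j then alpha j - (M - alpha i) else alpha k.
have alpha'0 k : k \in A -> 0 <= alpha' k.
  move=> kA; rewrite /alpha'; case: ifP => _; last exact: alpha0.
  by have := alpha0 _ iA; rewrite /M; lra.
have jAi : j \in A :\ i by rewrite !inE ji.
(* The total demand drops by exactly [M], and no agent loses more than [M] on [[a, x]], so the
   induction hypothesis applies on [[x, b]]. *)
have sum' : \sum_(k in A :\ i) alpha' k = \sum_(k in A) alpha k - M.
  rewrite (sumD i) // (big_setD1 j jAi) (big_setD1 j jAi (F := alpha)) /= /alpha' eqxx.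
  have -> : \sum_(k in A :\ i :\ j)
        (if k == j then alpha j - (M - alpha i) else alpha k) =
      \sum_(k in A :\ i :\ j) alpha k.
    by apply: eq_bigr => k /setD1P[/negbTE -> _].
  by lra.
have [|||||L1 [d1 s1 i1 j1]] :=
  @two_agents R I (F i) (F j) i j a x (alpha i) (M - alpha i)
    (cF i) (cF j) (hF i) (hF j) _ ax.
- by rewrite eq_sym.
- exact: alpha0.
- by rewrite subr_ge0.
- by rewrite /M; lra.
- by rewrite eij /M; lra.
have [| | | |L2 [d2 s2 sh2]] := IH (A :\ i) alpha' x b _ _ xb.
- by rewrite -ltnS -cardD.
- by rewrite -ltnS -cardD (leq_trans _ A3).
- by move=> k /setD1P[_ /alpha'0].
- move=> k /setD1P[_ kA]; move: (total k kA) (topi k kA).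
  by rewrite sum' /M; lra.
exists (L1 ++ L2); split.
- exact: is_division_cat d1 d2.
- by rewrite size_cat; move: s1 s2 A3; rewrite cardD; lia.
move=> k kA; rewrite share_cat (proj2 d1).
(* Only [j] needs both parts; for the others the second part can only help, as shares are
   non-negative. *)
have ge1 : 0 <= share (F k) k a L1 by apply: share_ge0 => //; case: d1.
have [ki|ki] := eqVneq k i.
  by subst k; rewrite (le_trans i1) // lerDl share_ge0 //; case: d2.
have {sh2}: alpha' k <= share (F k) k x L2 by apply: sh2; rewrite !inE ki.
rewrite /alpha'; have [kj|_] := eqVneq k j; last by lra.
by subst k; lra.
Qed.

End Existence.

(** * Distribution functions of non-atomic measures *)

Section DistributionFunction.
Context {R : realType}.
Context (mu : {measure set R -> \bar R}) (mu_prob : prob_on01 mu).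

Definition distrib (x : R) : R := fine (mu `]-oo, x]%classic).

Lemma prob_on01_fin A : measurable A -> mu A \is a fin_num.
Proof.
have [mu1 mu0] := mu_prob.
have muT : mu setT = 1%E.
  rewrite -(setUv `[0%R, 1%R]%classic) measureU ?setICr //; last exact: measurableC.
  by rewrite [X in (X + _)%E]mu1 [X in (_ + X)%E]mu0 adde0.
move=> mA; rewrite ge0_fin_numE // (@le_lt_trans _ _ (mu setT)) ?muT ?ltry //.
by rewrite -muT le_measure ?inE.
Qed.

Lemma prob_on01_itv a b : a <= b -> mu `]a, b]%classic = (distrib b - distrib a)%:E.
Proof.
move=> ab; rewrite EFinB /distrib !fineK ?prob_on01_fin //.
have -> : `]-oo, b]%classic = `]-oo, a]%classic `|` `]a, b]%classic.
  by apply: itv_bndbnd_setU; rewrite ?bnd_simp.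
rewrite measureU //; last first.
  apply/seteqP; split => x //= [] /=; rewrite !in_itv /= => xa /andP[ax _].
  by move: ax; rewrite ltNge xa.
by rewrite addeAC subee ?prob_on01_fin // add0e.
Qed.

Lemma distrib_homo : {homo distrib : x y / x <= y}.
Proof.
by move=> x y xy; rewrite -subr_ge0 -lee_fin -prob_on01_itv // measure_ge0.
Qed.

(** A point of positive mass would be an atom, its only subsets being the empty set and itself. *)
Lemma nonatomic_set1 x : nonatomic mu -> mu [set x] = 0%E.
Proof.
move=> na; apply/eqP; rewrite eq_le measure_ge0 andbT leNgt; apply/negP => x0.
have [B [_ Bx]] := na [set x] (measurable_set1 x) x0.
have [-> | ->] := subset_set1 Bx; first by rewrite measure0 ltxx.
by rewrite ltxx andbF.
Qed.

(** The intervals [J n] shrink to the null set [[set x]], so their measures tend to 0; by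
    monotonicity these measures bound the oscillation of [distrib] near [x]. *)
Lemma distrib_continuous : nonatomic mu -> continuous distrib.
Proof.
move=> na x; apply/cvgrPdist_le => e e0.
pose J n := `](x - n.+1%:R^-1), (x + n.+1%:R^-1)]%classic.
have capJ : \bigcap_n J n = [set x].
  apply/seteqP; split => [y Jy|y -> n _]; last first.
    by rewrite /J /= in_itv /= gtrBl lerDl invr_gt0 invr_ge0 ltr0n ler0n.
  apply: contrapT => /eqP; rewrite -subr_eq0 -normr_gt0 => yx.
  have [n _ /(_ _ (leqnn n)) /=] := near_infty_natSinv_lt (PosNum yx).
  have := Jy n Logic.I; rewrite /J /= in_itv /= => /andP[h1 h2].
  apply/negP; rewrite -leNgt ler_norml; move: h1 h2.
  by move: (_^-1) => d h1 h2; apply/andP; split; lra.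
have cvgJ : mu \o J @ \oo --> mu (\bigcap_n J n).
  apply: nonincreasing_cvg_mu => //.
  - by rewrite ltey_eq prob_on01_fin //; exact: measurable_itv.
  - by move=> n; exact: measurable_itv.
  - by rewrite capJ; exact: measurable_set1.
  - move=> m n mn; apply/subsetPset => y; rewrite /J /= !in_itv /= => /andP[h1 h2].
    have : (n.+1%:R^-1 : R) <= m.+1%:R^-1 by rewrite lef_pV2 ?posrE ?ltr0n // ler_nat.
    move: h1 h2; move: (_.+1%:R^-1) (_.+1%:R^-1) => p q h1 h2 h.
    by apply/andP; split; lra.
rewrite capJ nonatomic_set1 // in cvgJ.
have /cvgJ[n _ /(_ _ (leqnn n)) /=] : nbhs 0%E [set y | (y < e%:E)%E].
  exact: (nbhs_open_ereal_lt (f := fun=> e) e0).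
pose d : R := n.+1%:R^-1.
have d0 : 0 < d by rewrite invr_gt0 ltr0n.
rewrite /J -/d prob_on01_itv ?lte_fin; last by lra.
move=> small.
near=> t.
have : `|x - t| <= d by near: t; exact: (@cvgr_dist_le _ _ _ _ _ id x cvg_id).
rewrite ler_norml => /andP[h1 h2].
have k1 : distrib t <= distrib (x + d) by apply: distrib_homo; lra.
have k2 : distrib (x - d) <= distrib t by apply: distrib_homo; lra.
have k3 : distrib x <= distrib (x + d) by apply: distrib_homo; lra.
have k4 : distrib (x - d) <= distrib x by apply: distrib_homo; lra.
by rewrite ler_norml; apply/andP; split; lra.
Unshelve. all: by end_near. Qed.

Context {I : finType}.

(** Half-open intervals are disjoint and their measures are increments of [distrib], so the first
    one can be split off inductively. *)
Lemma share_owner i0 (i : I) (L : seq (I * R)) a b : is_division a b L ->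
  measurable [set x | `]a, b]%classic x /\ owner i0 L x = i] /\
  mu [set x | `]a, b]%classic x /\ owner i0 L x = i] = (share distrib i a L)%:E.
Proof.
elim: L a => [|[l r] L IH] a [].
  move=> /= _ ->; rewrite (_ : [set _ | _] = set0) ?measure0 //.
  apply/seteqP; split => x //= []; rewrite in_itv /=.
  by move=> /andP[/lt_le_trans h /h]; rewrite ltxx.
move=> /= /andP[ar pL] lL.
have [mL muL] := IH r (conj pL lL).
have rb : r <= b.
  have /allP ler := order_path_min le_trans pL.
  by have := mem_last r (map snd L); rewrite lL inE => /predU1P[-> //|/ler].
pose T : set R := if l == i then `]a, r]%classic else set0.
have mT : measurable T by rewrite /T; case: ifP.
have -> : [set x | x \in `]a, b] /\ (if x <= r then l else owner i0 L x) = i] =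
    T `|` [set x | `]r, b]%classic x /\ owner i0 L x = i].
  apply/seteqP; split => x /=; rewrite /T.
    rewrite !in_itv /= => -[/andP[ax xb]]; case: leP => xr.
      by move=> ->; left; rewrite eqxx /= in_itv /= ax.
    by move=> <-; right; rewrite xb.
  rewrite !in_itv /=; case => [|[/andP[rx xb] <-]].
    case: eqP => // ->; rewrite /= in_itv /= => /andP[ax xr].
    by rewrite ax xr (le_trans xr).
  by rewrite (le_lt_trans ar) // xb leNgt rx.
split; first exact: measurableU.
rewrite measureU //; last first.
  apply/seteqP; split => x //= []; rewrite /T; case: ifP => // _ /=.
  by rewrite !in_itv /= => /andP[_ xr] [/andP[]]; rewrite ltNge xr.
rewrite EFinD -muL /T; congr (_ + _)%E; case: ifP => _; last by rewrite measure0.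
exact: prob_on01_itv.
Qed.

End DistributionFunction.

(** * From lists of intervals back to sets and cut points *)

Theorem theorem1 (R : realType) (n : nat)
    (mu : 'I_n -> {measure set R -> \bar R}) (alpha : 'I_n -> R) :
  (2 <= n)%N ->
  (forall i, prob_on01 (mu i)) ->
  (forall i, nonatomic (mu i)) ->
  (forall i, 0 <= alpha i) ->
  \sum_(i < n) alpha i = 1 ->
  exists (s : seq R) (f : nat -> 'I_n) (X : 'I_n -> set R),
    [/\ (size s <= 3 * n - 4)%N,
        sorted <%R (cut_points s) &
        (forall i, measurable (X i))] /\
    [/\
        (forall i j, i != j -> X i `&` X j = set0),
        \bigcup_i X i = `[0%R, 1%R]%classic,
        (forall j, (j < size s + 1)%N -> piece s j `<=` X (f j)) &
        (forall i, ((alpha i)%:E <= mu i (X i))%E)].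
Proof.
move=> n2 pr na alpha0 sum1.
have n0 : (0 < n)%N by apply: leq_trans n2.
pose i0 := Ordinal n0.
have ab : 0 <= 1 :> R by [].
(* The point 0 is null, so the half-open unit interval has full mass. *)
have total i : 1 = distrib (mu i) 1 - distrib (mu i) 0.
  apply: EFin_inj; rewrite -prob_on01_itv //.
  have <- : mu i `[0%R, 1%R]%classic = 1%E by case: (pr i).
  rewrite -(@setU1itv _ _ (BRight 1) 0 false) ?bnd_simp // measureU //.
    by rewrite [X in (X + _)%E]nonatomic_set1 ?add0e.
  by apply/seteqP; split => x //= [->]; rewrite in_itv /= ltxx.
have [|||||L0 [[pL0 lL0] sL0 shL0]] := disproportionate_division
  (F := fun i => distrib (mu i)) (A := [set: 'I_n]) (alpha := alpha) (b := 1) _ _ _ ab.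
- by move=> i; exact: distrib_continuous.
- by move=> i; exact: distrib_homo.
- by rewrite cardsT card_ord.
- by [].
- move=> i _; rewrite -total -sum1 le_eqVlt; apply/orP; left; apply/eqP.
  by apply: eq_bigl => k; rewrite inE.
have [L [pL lL sL shL]] := share_strict pL0; rewrite lL0 in lL.
have dL : is_division 0 1 L.
  by split => //; apply: sub_path pL => x y /ltW.
have sizeL : (size L <= 3 * n - 3)%N.
  by apply: (leq_trans sL); move: sL0; rewrite cardsT card_ord; lia.
(* The last endpoint is 1, which is no cut: [3 * n - 3] intervals give [3 * n - 4] cuts. *)
have [s sE] : exists s, map snd L = rcons s 1.
  case/lastP: (map snd L) lL => [|t x] /=; first by move/eqP; rewrite eq_sym oner_eq0.
  by rewrite last_rcons => ->; exists t.
have cutsE : cut_points s = 0 :: map snd L by rewrite sE.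
have size_s : size L = (size s).+1 by rewrite -(size_map snd) sE size_rcons.
pose X i := [set x | `[0%R, 1%R]%classic x /\ owner i0 L x = i].
(* Shares compute the measure of [Y i]; [X i] differs from it at most by the point 0. *)
pose Y i := [set x | `]0%R, 1%R]%classic x /\ owner i0 L x = i].
have mY i : measurable (Y i) by case: (share_owner (pr i) i0 i dL).
have XE i : X i = (if owner i0 L 0 == i then [set 0] else set0) `|` Y i.
  have -> : X i = (`[0%R, 1%R]%classic `&` [set x | owner i0 L x = i]) by [].
  rewrite -(@setU1itv _ _ (BRight 1) 0 false) ?bnd_simp // setIUl; congr (_ `|` _).
  by case: eqP => o0; apply/seteqP; split => x //=; [case|move=> ->|case=> ->].
have mX i : measurable (X i).
  by rewrite XE; apply: measurableU => //; case: ifP.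
exists s, (nth i0 (map fst L)), X; split; split => //.
- by rewrite -ltnS -size_s (leq_trans sizeL) //; lia.
- by rewrite cutsE.
- move=> i j /eqP ij; apply/seteqP; split => x //= [[_ xi] [_ xj]].
  by apply: ij; rewrite -xi.
- by apply/seteqP; split => x /=; [case=> i _ [] | exists (owner i0 L x)].
- move=> j; rewrite addn1 -size_s => jL x; rewrite /piece cutsE /= in_itv /= => xj.
  split; last by apply: owner_piece xj => //; case: dL.
  have srt : sorted <=%R (0 :: map snd L) by case: dL.
  have /andP[/ltW lo /ltW hi] := xj.
  rewrite /= in_itv /=; apply/andP; split.
    apply: le_trans lo.
    by apply: (sorted_leq_nth le_trans lexx 0 srt 0%N j); rewrite ?inE //= size_map ltnW.
  apply: (le_trans hi).
  have <- : nth 0 (0 :: map snd L) (size L) = 1.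
    by rewrite -[X in nth _ _ X](size_map snd) nth_last.
  apply: (sorted_leq_nth le_trans lexx 0 srt j.+1 (size L));
    by rewrite ?inE //= size_map ltnS.
- move=> i; apply: (@le_trans _ _ (mu i (Y i))).
    have [_ ->] := share_owner (pr i) i0 i dL.
    by rewrite lee_fin shL shL0 ?inE.
  by rewrite le_measure ?inE // XE; apply: subsetUr.
Qed.
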